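(* Let $T$ be a bounded, linear, bijective operator on $L^2(G,\mathbb{C}^{s\times r})$ that is adjointable with respect to the matrix-valued inner product, and let $\{E_k\}_{k\in\mathbb{N}}$ be a matrix-valued orthonormal basis for $L^2(G,\mathbb{C}^{s\times r})$. If $T$ is positive, then $\{TE_k\}_{k\in\mathbb{N}}$ is a matrix-valued Riesz basis for $L^2(G,\mathbb{C}^{s\times r})$ if and only if $\{T^{1/2}E_k\}_{k\in\mathbb{N}}$ is a matrix-valued Riesz basis for $L^2(G,\mathbb{C}^{s\times r})$.
   Context: $G$ is a locally compact abelian group that is metrizable and $\sigma$-compact, with Haar measure $\mu_G$; $s,r\in\mathbb{N}$. $L^2(G,\mathbb{C}^{s\times r})$ is the space of $s\times r$ matrices $\mathbf{f}=[f_{ij}]$ with all entries in $L^2(G)$. The matrix-valued inner product is $\langle \mathbf{f},\mathbf{g}\rangle=\int_G \mathbf{f}(x)\mathbf{g}^*(x)\,d\mu_G\in M_s(\mathbb{C})$ (entrywise integral). $L^2(G,\mathbb{C}^{s\times r})$ is a Hilbert space with inner product $\langle \mathbf{f},\mathbf{g}\rangle_{L^2}=\mathrm{tr}\langle \mathbf{f},\mathbf{g}\rangle$ and Frobenius norm $\|\mathbf{f}\|=(\sum_{i,j}\int_G|f_{ij}|^2d\mu_G)^{1/2}$; $U^*$ denotes the Hilbert-adjoint with respect to this inner product. $U$ is adjointable with respect to the matrix-valued inner product if $\langle U\mathbf{f},\mathbf{g}\rangle=\langle\mathbf{f},U^*\mathbf{g}\rangle$ for all $\mathbf{f},\mathbf{g}$.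 $T$ is positive if $T^*=T$ and $\mathrm{tr}\langle T\mathbf{f},\mathbf{f}\rangle\ge0$ for all $\mathbf{f}$; $T^{1/2}$ is the unique bounded positive operator $W$ with $W^2=T$. A matrix-valued orthonormal basis is a sequence $\{E_k\}_{k\in\mathbb{N}}$ with $\langle E_k,E_j\rangle=\mathbf{I}_{s\times s}$ if $k=j$ and $\mathbf{O}_{s\times s}$ otherwise, such that $\mathbf{f}=\sum_k\langle\mathbf{f},E_k\rangle E_k$ in Frobenius norm for all $\mathbf{f}$. A matrix-valued Riesz basis is a family $\{UE_k\}_{k\in\mathbb{N}}$ with $\{E_k\}$ a matrix-valued orthonormal basis and $U$ bounded, linear, bijective and adjointable with respect to the matrix-valued inner product. *)

(* Defs.v *)
From HB Require Import structures.
From mathcomp Require Import all_boot all_order all_algebra.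
From mathcomp Require Import all_classical all_reals all_analysis.
From mathcomp Require Import complex.

Set Implicit Arguments.
Unset Strict Implicit.
Unset Printing Implicit Defensive.

Import Order.TTheory GRing.Theory Num.Theory.
Import numFieldNormedType.Exports.
Local Open Scope classical_set_scope.
Local Open Scope ring_scope.

Notation Cplx R := (complex.complex R).

Section BorelType.
Variable G : topologicalZmodType.
(* G seen as a pointed type (point 0), needed for the generated sigma-algebra *)
Definition pointedG : Type := G.
HB.instance Definition _ := Choice.on pointedG.
HB.instance Definition _ := isPointed.Build pointedG (0%R : G).
Definition borelType : Type :=
  g_sigma_algebraType (fun A : set pointedG => @open G A).
End BorelType.


Definition metrizable_top (R : realType) (G : topologicalType) : Prop :=
  exists d : G -> G -> R,
    [/\ (forall x y, 0 <= d x y), (forall x y, d x y = 0 <-> x = y),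
        (forall x y, d x y = d y x), (forall x y z, d x z <= d x y + d y z)
      & (forall x (A : set G), nbhs x A <->
           exists2 e : R, 0 < e & [set y | d x y < e] `<=` A)].

Definition sigma_compact_top (G : topologicalType) : Prop :=
  exists K : nat -> set G, (forall n, compact (K n)) /\ \bigcup_n K n = setT.

Definition LCA_metrizable_sigma_compact (R : realType) (G : topologicalZmodType) : Prop :=
  [/\ hausdorff_space G, locally_compact [set: G], metrizable_top R G
    & sigma_compact_top G].

Definition Haar_measure (R : realType) (G : topologicalZmodType)
    (mu : {measure set (borelType G) -> \bar R}) : Prop :=
  [/\ (forall (x : G) (A : set (borelType G)), measurable A ->
         mu ((fun a : borelType G => (@GRing.add G x a : borelType G)) @` A) = mu A),
      (forall K : set G, compact K -> (mu K < +oo)%E),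
      (forall A : set (borelType G), measurable A ->
         mu A = ereal_inf [set mu U | U in [set U : set (borelType G) |
                                      @open G U /\ A `<=` U]]),
      (forall U : set G, open U ->
         mu U = ereal_sup [set mu K | K in [set K : set (borelType G) |
                                      @compact G K /\ K `<=` U]])
    & (0 < mu setT)%E].

Section L2.
Variables (R : realType) (G : topologicalZmodType)
  (mu : {measure set (borelType G) -> \bar R}) (s r : nat).

Local Notation C := (Cplx R).
Local Notation Mf := (borelType G -> 'M[C]_(s, r)).

Definition inL2 (f : Mf) : Prop :=
  forall (i : 'I_s) (j : 'I_r),
    [/\ measurable_fun setT (fun x => complex.Re (f x i j)),
        measurable_fun setT (fun x => complex.Im (f x i j))
      & (\int[mu]_x ((complex.Re (f x i j)) ^+ 2 + (complex.Im (f x i j)) ^+ 2)%:E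
          < +oo)%E].

Definition aeq (f g : Mf) : Prop := {ae mu, forall x, f x = g x}.

Definition cintegral (h : borelType G -> C) : C :=
  complex.Complex (\int[mu]_x complex.Re (h x))%R (\int[mu]_x complex.Im (h x))%R.

Definition mip (f g : Mf) : 'M[C]_s :=
  \matrix_(i, k) cintegral (fun x => (f x *m (map_mx Num.conj (g x))^T) i k).

Definition hip (f g : Mf) : C := \tr (mip f g).

Definition fnorm (f : Mf) : R :=
  Num.sqrt (\sum_(i < s) \sum_(j < r)
     (\int[mu]_x ((complex.Re (f x i j)) ^+ 2 + (complex.Im (f x i j)) ^+ 2))%R).

(** operators: maps on functions which preserve L^2 and respect a.e. equality *)
Definition op_wd (U : Mf -> Mf) : Prop :=
  (forall f, inL2 f -> inL2 (U f)) /\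
  (forall f g, inL2 f -> inL2 g -> aeq f g -> aeq (U f) (U g)).

Definition op_linear (U : Mf -> Mf) : Prop :=
  forall (a : C) f g, inL2 f -> inL2 g ->
    aeq (U (fun x => a *: f x + g x)) (fun x => a *: U f x + U g x).

Definition op_bounded (U : Mf -> Mf) : Prop :=
  exists c : R, forall f, inL2 f -> fnorm (U f) <= c * fnorm f.

Definition op_bijective (U : Mf -> Mf) : Prop :=
  (forall f g, inL2 f -> inL2 g -> aeq (U f) (U g) -> aeq f g) /\
  (forall g, inL2 g -> exists2 f, inL2 f & aeq (U f) g).

Definition op_adjointable (U : Mf -> Mf) : Prop :=
  exists2 V : Mf -> Mf, op_wd V &
    forall f g, inL2 f -> inL2 g -> mip (U f) g = mip f (V g).

Definition good_op (U : Mf -> Mf) : Prop :=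
  [/\ op_wd U, op_linear U, op_bounded U, op_bijective U & op_adjointable U].

Definition op_positive (U : Mf -> Mf) : Prop :=
  (forall f g, inL2 f -> inL2 g -> hip (U f) g = hip f (U g)) /\
  (forall f, inL2 f -> 0 <= hip (U f) f).

Definition is_sqrt_op (T W : Mf -> Mf) : Prop :=
  [/\ op_wd W, op_linear W, op_bounded W, op_positive W
    & forall f, inL2 f -> aeq (W (W f)) (T f)].

Definition mx_ONB (E : nat -> Mf) : Prop :=
  [/\ (forall k, inL2 (E k)),
      (forall k j, mip (E k) (E j) = if k == j then 1%:M else 0)
    & (forall f, inL2 f ->
         (fun n : nat => fnorm (fun x => f x - \sum_(k < n) mip f (E k) *m E k x))
           @ \oo --> (0 : R))].

Definition mx_Riesz_basis (F : nat -> Mf) : Prop :=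
  exists E : nat -> Mf, exists U : Mf -> Mf,
    [/\ mx_ONB E, good_op U & forall k, aeq (F k) (U (E k))].

End L2.

(* Main.v *)
(* [T] itself is a good operator and [E] an orthonormal basis, so [{T E_k}] is a
   Riesz basis by definition; the content is that [W = T^{1/2}] is a good operator,
   so that [{W E_k}] is one as well. Bijectivity of [W] follows from [W^2 = T].
   For adjointability, [T] is adjointable for the matrix-valued inner product and
   hence commutes with left multiplication by constant matrices [A]. So does [W],
   being a strong limit of polynomials in [W^2 = T]; comparing
   [tr (A <W f, g>)] and [tr (A <f, W g>)] for all [A] gives
   [<W f, g> = <f, W g>].

   Polynomial approximation: after scaling to [0 <= W <= 1], put [e_0 = 0] and
   [e_{n+1} = e_n + (W^2 - e_n^2) / 2]. The remainder [r_n = W - e_n] satisfies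
   [r_{n+1} = r_n (1 - W + r_n / 2)], so [e_n] and [r_n] lie in the cone generated
   by products of [W] and [1 - W], which consists of positive operators. Hence
   [|r_n x|^2 <= 2 (<r_n x, x> - <r_{n+1} x, x>)], and the right-hand side
   telescopes. No completeness of the space is used. *)
Require Import Defs.
From HB Require Import structures.
From mathcomp Require Import all_boot all_order all_algebra.
From mathcomp Require Import all_classical all_reals all_analysis.
From mathcomp Require Import complex.
From mathcomp Require Import measurable_realfun.
From mathcomp Require Import ring lra.

Set Implicit Arguments.
Unset Strict Implicit.
Unset Printing Implicit Defensive.
Import Order.TTheory GRing.Theory Num.Theory.
Local Open Scope classical_set_scope.
Local Open Scope ring_scope.

(** Summing the first [n] bounds gives [n D <= K b_0], which an Archimedean field forbids for large
    [n] unless [D = 0]. This replaces any passage to a limit. *)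
Lemma telescope_bound_eq0 (C : numFieldType) (b : nat -> C) (K D : C) :
  (forall x : C, exists n, `|x| < n%:R) -> (forall n, 0 <= b n) ->
  0 <= D -> (forall n, D <= K * (b n - b n.+1)) -> 0 <= K -> D = 0.
Proof.
move=> arch b_ge0 D_ge0 Db K_ge0; apply/eqP/negPn/negP => D_neq0.
have D_gt0 : 0 < D by rewrite lt_def D_neq0.
have Dn n : n%:R * D <= K * (b 0%N - b n).
  elim: n => [|n IH]; first by rewrite mul0r subrr mulr0.
  by have := lerD IH (Db n); rewrite -mulrDr addrA subrK -natr1 mulrDl mul1r.
have [n] := arch (K * b 0%N / D).
rewrite ger0_norm; last by rewrite divr_ge0 ?mulr_ge0.
rewrite ltr_pdivrMr // => /lt_le_trans/(_ (Dn n)).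
by rewrite mulrBr ltrDl oppr_gt0 le_gtF ?mulr_ge0.
Qed.

(** * Semi-inner products, without definiteness or completeness *)

Section SemiInnerProduct.
Variables (C : numClosedFieldType) (V : lmodType C) (h : V -> V -> C).
Hypothesis hP : forall a x y z, h (a *: x + y) z = a * h x z + h y z.
Hypothesis hC : forall x y, h y x = (h x y)^*.
Hypothesis h_ge0 : forall x, 0 <= h x x.

Lemma sipD x y z : h (x + y) z = h x z + h y z.
Proof. by rewrite -[x]scale1r hP mul1r scale1r. Qed.

Lemma sip0 z : h 0 z = 0.
Proof. by apply: (addrI (h 0 z)); rewrite -sipD !addr0. Qed.

Lemma sipZ a x z : h (a *: x) z = a * h x z.
Proof. by rewrite -[a *: x]addr0 hP sip0 addr0. Qed.

Lemma sipN x z : h (- x) z = - h x z.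
Proof. by rewrite -scaleN1r sipZ mulN1r. Qed.

Lemma sipB x y z : h (x - y) z = h x z - h y z.
Proof. by rewrite sipD sipN. Qed.

Lemma sipDr z x y : h z (x + y) = h z x + h z y.
Proof. by rewrite hC sipD rmorphD /= -(hC x) -(hC y). Qed.

Lemma sipNr z x : h z (- x) = - h z x.
Proof. by rewrite hC sipN rmorphN /= -hC. Qed.

Lemma sipBr z x y : h z (x - y) = h z x - h z y.
Proof. by rewrite sipDr sipNr. Qed.

Lemma sipZr a z x : h z (a *: x) = a^* * h z x.
Proof. by rewrite hC sipZ rmorphM /= -hC. Qed.

(* A weak form of Cauchy-Schwarz, valid without definiteness:
   expand [0 <= h (u - t k z) (u - t k z)] at [t = 1 / (1 + h z z)]. *)
Lemma sip_normsq_le u z : `|h u z| ^+ 2 <= (1 + h z z) * h u u.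
Proof.
set k := h u z; set m := 1 + h z z.
have m_gt0 : 0 < m by rewrite ltr_pwDl ?ltr01.
have mJ : m^-1^* = m^-1 by apply: CrealP; rewrite realV gtr0_real.
have /(mulr_ge0 (ltW m_gt0)) := h_ge0 (u - (m^-1 * k) *: z).
have -> : h (u - (m^-1 * k) *: z) (u - (m^-1 * k) *: z)
   = h u u - 2 * (m^-1 * `|k| ^+ 2) + m^-1 ^+ 2 * `|k| ^+ 2 * (m - 1).
  rewrite !(sipB, sipBr, sipZ, sipZr) rmorphM /= mJ (hC u z) -/k normCK /m; ring.
have -> : m * (h u u - 2 * (m^-1 * `|k| ^+ 2) + m^-1 ^+ 2 * `|k| ^+ 2 * (m - 1))
   = m * h u u - `|k| ^+ 2 - m^-1 * `|k| ^+ 2.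
  by field; rewrite gt_eqF.
rewrite -addrA -opprD subr_ge0; apply: le_trans.
by rewrite lerDl mulr_ge0 ?exprn_ge0 // invr_ge0 ltW.
Qed.

(* Vectors with the same pairings are identified by writing [h u = h v]. *)
Definition symop (F : V -> V) := forall x y, h (F x) y = h x (F y).
Definition commop (F K : V -> V) := forall x, h (F (K x)) = h (K (F x)).

(** Operators are not assumed linear here: symmetry moves [F] to the other argument, where linearity
    of [h] gives linearity of every pairing. *)
Lemma symopD F x y z : symop F -> h (F (x + y)) z = h (F x) z + h (F y) z.
Proof. by move=> sF; rewrite !sF sipD. Qed.

Lemma symopN F x z : symop F -> h (F (- x)) z = - h (F x) z.
Proof. by move=> sF; rewrite !sF sipN. Qed.

Lemma symopB F x y z : symop F -> h (F (x - y)) z = h (F x) z - h (F y) z.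
Proof. by move=> sF; rewrite !sF sipB. Qed.

Lemma symopZ F a x z : symop F -> h (F (a *: x)) z = a * h (F x) z.
Proof. by move=> sF; rewrite !sF sipZ. Qed.

Lemma symop_congr F u v : symop F -> h u = h v -> h (F u) = h (F v).
Proof. by move=> sF uv; apply/funext => z; rewrite !sF uv. Qed.

Lemma sip_congr u v z : h u = h v -> h z u = h z v.
Proof. by move=> uv; rewrite hC uv -hC. Qed.

Lemma symop_iter F n : symop F -> symop (iter n F).
Proof. by move=> sF; elim: n => // n IH x y; rewrite iterS sF IH -iterSr. Qed.

Lemma commop_iter F K n : symop F -> commop F K -> commop (iter n F) K.
Proof.
move=> sF FK; elim: n => //= n IH x.
by rewrite (symop_congr sF (IH x)) FK.
Qed.

(** * The positive cone generated by [W] and [B = 1 - W] *)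

Variable W : V -> V.
Hypothesis W_sym : symop W.
Hypothesis W_ge0 : forall x, 0 <= h (W x) x.
Hypothesis W_le1 : forall x, h (W x) x <= h x x.

Let B x := x - W x.

Lemma compl_sym : symop B.
Proof. by move=> x y; rewrite /B sipB sipBr W_sym. Qed.

Lemma compl_comm : commop W B.
Proof.
by move=> x; apply/funext => z; rewrite /B sipB symopB.
Qed.

(** By symmetry, two equal factors can be split between the two arguments of [h], which lowers an
    exponent by 2. This leaves the exponents 0 and 1. *)
Lemma sip_monomial_ge0 i j x : 0 <= h x (iter j B (iter i W x)).
Proof.
elim/ltn_ind: i j x => -[|[|i]] IHi; last first.
- move=> j x; rewrite iterS iterSr.
  have BW : commop B W by move=> y; rewrite compl_comm.
  rewrite (sip_congr _ (commop_iter j compl_sym BW _)) -W_sym.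
  exact: IHi.
- elim/ltn_ind => -[|[|j]] IHj x; first by rewrite /= -W_sym.
    (* Since [W + B = 1], one has [W B = B W B + W B W], and both terms are positive because [W] and
       [B] are. *)
    rewrite /=; have -> : h x (B (W x)) = h (W (B x)) (B x) + h (B (W x)) (W x).
      by rewrite -(compl_comm x) -sipDr subrK W_sym compl_sym.
    by rewrite addr_ge0 // sipB subr_ge0.
  rewrite iterS -compl_sym iterSr.
  by rewrite (sip_congr _ (symop_congr (symop_iter j compl_sym) (esym (compl_comm x)))) IHj.
- elim/ltn_ind => -[|[|j]] IHj x; first exact: h_ge0.
    by rewrite /= /B sipBr subr_ge0 -W_sym.
  by rewrite iterS -compl_sym iterSr IHj.
Qed.

(* A product of positive operators need not be visibly positive, whereas [conic]
   is stable under composition by construction. *)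
Definition posop (Q : V -> V) :=
  forall i j x, 0 <= h (Q x) (iter j B (iter i W x)).
Definition conic (F : V -> V) := forall Q, posop Q -> posop (F \o Q).

Lemma posop_id : posop id. Proof. by move=> i j x; exact: sip_monomial_ge0. Qed.

Lemma conic_ge0 F x : conic F -> 0 <= h (F x) x.
Proof. by move=> /(_ _ posop_id 0%N 0%N x). Qed.

(** Moving [W] to the second argument only raises an exponent of the monomial against which [Q] is
    tested. *)
Lemma conic_W : conic W.
Proof.
move=> Q Q0 i j x; rewrite /= W_sym.
have BW : commop B W by move=> y; rewrite compl_comm.
by rewrite -(sip_congr _ (commop_iter j compl_sym BW _)) -iterS.
Qed.

Lemma conic_compl : conic B.
Proof. by move=> Q Q0 i j x; rewrite /= compl_sym -iterS. Qed.

Lemma conicD F K : conic F -> conic K -> conic (fun x => F x + K x).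
Proof.
by move=> F0 K0 Q Q0 i j x; rewrite /= sipD addr_ge0 //; [apply: F0|apply: K0].
Qed.

Lemma conicZ a F : 0 <= a -> conic F -> conic (fun x => a *: F x).
Proof. by move=> a0 F0 Q Q0 i j x; rewrite /= sipZ mulr_ge0 //; apply: F0. Qed.

Lemma conic_comp F K : conic F -> conic K -> conic (F \o K).
Proof. by move=> F0 K0 Q Q0; exact: (F0 (K \o Q) (K0 _ Q0)). Qed.

Lemma eq_conic F K : (forall x, h (F x) = h (K x)) -> conic F -> conic K.
Proof. by move=> FK F0 Q Q0 i j x; rewrite /= -FK; apply: F0. Qed.

(** * The approximants [e_n] ([sqrt_iter]) and remainders [r_n] ([rem_iter]) *)

Fixpoint sqrt_iter n x : V :=
  if n is m.+1 then
    sqrt_iter m x + 2^-1 *: (W (W x) - sqrt_iter m (sqrt_iter m x))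
  else 0.
Let rem_iter n x := W x - sqrt_iter n x.

Let half_conj : (2^-1 : C)^* = 2^-1.
Proof. by rewrite fmorphV rmorph_nat. Qed.

Lemma sqrt_iter_sym n : symop (sqrt_iter n).
Proof.
elim: n => [|n IH] x y /=; first by rewrite sip0 hC sip0 rmorph0.
by rewrite !(sipD, sipZ, sipN, sipDr, sipZr, sipNr) half_conj !IH !W_sym.
Qed.

Lemma rem_iter_sym n : symop (rem_iter n).
Proof. by move=> x y; rewrite sipB sipBr W_sym sqrt_iter_sym. Qed.

(** The recursion involves [W] only through its square, so induction on [n] applies. The formal
    adjoint [S'] supplies the linearity of [S] under pairings. *)
Lemma sqrt_iter_comm (S S' : V -> V) n : (forall x y, h (S x) y = h x (S' y)) ->
  (forall x, h (S (W (W x))) = h (W (W (S x)))) -> commop (sqrt_iter n) S.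
Proof.
move=> SS' SW; elim: n => [|n IH] x; apply/funext => y /=.
  by rewrite SS' !sip0.
rewrite SS' !(sipD, sipZ, sipN) -!SS' -SW IH; congr (_ + _ * (_ - _)).
by rewrite sqrt_iter_sym IH -sqrt_iter_sym IH.
Qed.

Lemma sqrt_iter_commW n : commop (sqrt_iter n) W.
Proof. by apply: (sqrt_iter_comm n W_sym). Qed.

(** As [e_n] commutes with [W], the recursion factors as [e_{n+1} = e_n + r_n (W + e_n) / 2] and
    [r_{n+1} = r_n (B + r_n / 2)]. The right-hand sides use only sums, nonnegative multiples and
    compositions of conic operators. *)
Lemma sqrt_rem_conic n : conic (sqrt_iter n) /\ conic (rem_iter n).
Proof.
have h2 : 0 <= 2^-1 :> C by rewrite invr_ge0 ler0n.
elim: n => [|n [IHe IHr]].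
  split; first by move=> Q Q0 i j x /=; rewrite sip0.
  by apply: eq_conic conic_W => x; rewrite /rem_iter /= subr0.
pose symE := (symopN _ _ W_sym, symopD _ _ _ W_sym, symopZ _ _ _ W_sym,
  symopN _ _ (sqrt_iter_sym n), symopD _ _ _ (sqrt_iter_sym n),
  symopZ _ _ _ (sqrt_iter_sym n)).
split.
  have := conicD IHe (conicZ h2 (conic_comp IHr (conicD conic_W IHe))).
  apply: eq_conic => x; apply/funext => y; rewrite /rem_iter /=.
  by rewrite !(sipD, sipZ, sipN) !symE sqrt_iter_commW; ring.
have := conic_comp IHr (conicD conic_compl (conicZ h2 IHr)).
apply: eq_conic => x; apply/funext => y; rewrite /rem_iter /B /=.
by rewrite !(sipD, sipZ, sipN) !symE sqrt_iter_commW; field.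
Qed.

(** The difference of the two sides is the quadratic form of [2 r_n e_n], since
    [2 (r_n - r_{n+1}) = r_n (W + e_n)] and [r_n = W - e_n]. *)
Lemma rem_iter_sq_le n x :
  h (rem_iter n x) (rem_iter n x) <=
    2 * (h (rem_iter n x) x - h (rem_iter n.+1 x) x).
Proof.
have [e0 r0] := sqrt_rem_conic n.
rewrite -subr_ge0.
have := mulr_ge0 (ler0n C 2) (conic_ge0 x (conic_comp r0 e0)).
congr (0 <= _); rewrite -rem_iter_sym /rem_iter /=.
pose symE := (symopN _ _ W_sym, symopD _ _ _ W_sym, symopZ _ _ _ W_sym,
  symopN _ _ (sqrt_iter_sym n), symopD _ _ _ (sqrt_iter_sym n),
  symopZ _ _ _ (sqrt_iter_sym n)).
by rewrite !(sipD, sipZ, sipN) !symE sqrt_iter_commW; field.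
Qed.

Hypothesis archC : forall x : C, exists n, `|x| < n%:R.

Lemma sqrt_commute (S S' : V -> V) : (forall x y, h (S x) y = h x (S' y)) ->
  (forall x, h (S (W (W x))) = h (W (W (S x)))) -> commop S W.
Proof.
move=> SS' SW x; apply/funext => y; apply/eqP; rewrite -subr_eq0 -normr_eq0.
rewrite -sqrf_eq0; apply/eqP.
set u := fun n => rem_iter n x; set v := fun n => rem_iter n (S x).
pose b n := 2 * (h (u n) x + h (v n) (S x)).
(* The 2 comes from [(p + q)^2 <= 2 (p^2 + q^2)], and each [1 + h z z] from [sip_normsq_le]. *)
pose K := 2 * ((1 + h (S' y) (S' y)) + (1 + h y y)).
have K_ge0 : 0 <= K by rewrite !(mulr_ge0, addr_ge0) ?ler0n.
apply: (@telescope_bound_eq0 _ b K _ archC _ _ _ K_ge0) => [n||n].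
- by rewrite mulr_ge0 ?ler0n // addr_ge0 // conic_ge0 //; case: (sqrt_rem_conic n).
- by rewrite exprn_ge0.
(* [S] commutes with [e_n], so the commutator with [W] equals the commutator with [r_n], for every
   [n]. *)
have -> : h (S (W x)) y - h (W (S x)) y = h (u n) (S' y) - h (v n) y.
  rewrite /u /v /rem_iter !sipB -!SS' (sqrt_iter_comm n SS' SW); ring.
apply: (@le_trans _ _ (K * (h (u n) (u n) + h (v n) (v n)))); last first.
  rewrite ler_wpM2l // /b -mulrBr opprD addrACA mulrDr.
  by rewrite lerD ?rem_iter_sq_le.
have u0 := h_ge0 (u n); have v0 := h_ge0 (v n).
set p := h (u n) (S' y); set q := h (v n) y.
apply: (@le_trans _ _ (2 * (`|p| ^+ 2 + `|q| ^+ 2))).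
  apply: (@le_trans _ _ ((`|p| + `|q|) ^+ 2)).
    by rewrite lerXn2r ?nnegrE ?addr_ge0 // ler_normB.
  rewrite -subr_ge0.
  have -> : 2 * (`|p| ^+ 2 + `|q| ^+ 2) - (`|p| + `|q|) ^+ 2 = (`|p| - `|q|) ^+ 2.
    by ring.
  by rewrite real_exprn_even_ge0 // rpredB ?normr_real.
rewrite /K -mulrA ler_wpM2l ?ler0n // mulrDl !mulrDr.
by rewrite lerD // (le_trans (sip_normsq_le _ _)) // (lerDl, lerDr) mulr_ge0 // addr_ge0.
Qed.

End SemiInnerProduct.

(** Dividing [W] by its bound [c] reduces to the case [0 <= W <= 1]; commutation is unaffected by
    the scaling. *)
Lemma bounded_sqrt_commute (C : numClosedFieldType) (V : lmodType C)
    (h : V -> V -> C) (W S S' : V -> V) (c : C) :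
  (forall a x y z, h (a *: x + y) z = a * h x z + h y z) ->
  (forall x y, h y x = (h x y)^*) -> (forall x, 0 <= h x x) ->
  (forall x : C, exists n, `|x| < n%:R) ->
  symop h W -> (forall x, 0 <= h (W x) x) ->
  0 < c -> (forall x, h (W x) (W x) <= c ^+ 2 * h x x) ->
  (forall x y, h (S x) y = h x (S' y)) ->
  (forall x, h (S (W (W x))) = h (W (W (S x)))) -> commop h S W.
Proof.
move=> hP hC h_ge0 arch W_sym W_ge0 c_gt0 W_le SS' SW.
have cVJ : c^-1^* = c^-1 by apply: CrealP; rewrite realV gtr0_real.
have cJ : c^* = c by apply: CrealP; rewrite gtr0_real.
have c_neq0 : c != 0 by rewrite gt_eqF.
pose W1 x := c^-1 *: W x.
have W1_sym : symop h W1.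
  by move=> x y; rewrite /W1 (sipZ hP) (sipZr hP hC) cVJ W_sym.
have W1_ge0 x : 0 <= h (W1 x) x.
  by rewrite /W1 (sipZ hP) mulr_ge0 // invr_ge0 ltW.
have W1_le1 x : h (W1 x) x <= h x x.
  rewrite /W1 (sipZ hP) mulrC ler_pdivrMr // mulrC.
  rewrite -(ler_pM2l (mulr_gt0 (ltr0Sn C 1) c_gt0)) -subr_ge0.
  (* Expanding the square gives [2 c <W x, x> <= c^2 <x, x> + <W x, W x>], and the norm bound makes
     this at most [2 c^2 <x, x>]. *)
  apply: le_trans (h_ge0 (c *: x - W x)) _.
  rewrite -subr_ge0; have := W_le x; rewrite -subr_ge0; congr (0 <= _).
  rewrite !(sipB hP, sipBr hP hC, sipZ hP, sipZr hP hC) cJ -(W_sym x x); ring.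
have SW1 x : h (S (W1 (W1 x))) = h (W1 (W1 (S x))).
  apply/funext => y; rewrite SS' /W1 !(sipZ hP) !W_sym !(sipZ hP) -!W_sym -SS' SW.
  by [].
move=> x; have /(congr1 (fun f => f _)) := sqrt_commute hP hC h_ge0 W1_sym W1_ge0 W1_le1 arch SS' SW1 x.
move=> E; apply/funext => y; apply: (mulfI (invr_neq0 c_neq0)).
by have := E y; rewrite /W1 SS' !(sipZ hP) -SS'.
Qed.

(** * Real and imaginary parts of complex numbers *)

Section ComplexParts.
Variable R : realType.
Implicit Types z w : Cplx R.

Lemma ReM z w : complex.Re (z * w) =
  complex.Re z * complex.Re w - complex.Im z * complex.Im w.
Proof. by case: z w => [a b] [c d]. Qed.

Lemma ImM z w : complex.Im (z * w) =
  complex.Re z * complex.Im w + complex.Im z * complex.Re w.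
Proof. by case: z w => [a b] [c d]. Qed.

Lemma ReD z w : complex.Re (z + w) = complex.Re z + complex.Re w.
Proof. by case: z w => [a b] [c d]. Qed.

Lemma ImD z w : complex.Im (z + w) = complex.Im z + complex.Im w.
Proof. by case: z w => [a b] [c d]. Qed.

Lemma Re_conj z : complex.Re (Num.conj z) = complex.Re z.
Proof. by case: z. Qed.

Lemma Im_conj z : complex.Im (Num.conj z) = - complex.Im z.
Proof. by case: z. Qed.

Definition reimE := (ReM, ImM, ReD, ImD, Re_conj, Im_conj).

Lemma complex_archimedean (z : Cplx R) : exists n, `|z| < n%:R.
Proof.
exists (Num.bound (complex.Re `|z|)).
have := normr_ge0 z; set w := `|z|; rewrite lecE => /andP[/eqP w0 w_ge0].
rewrite -(rmorph_nat (real_complex R)) ltcE w0 /= eqxx /=.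
exact: archi_boundP.
Qed.
End ComplexParts.

(** * Integrable and square-integrable complex functions *)

Section SquareIntegrable.
Variables (R : realType) (G : topologicalZmodType)
  (mu : {measure set (borelType G) -> \bar R}).
Local Notation C := (Cplx R).
Implicit Types u v : borelType G -> C.

Definition cintegrable u : Prop :=
  mu.-integrable setT (EFin \o (fun x => complex.Re (u x))) /\
  mu.-integrable setT (EFin \o (fun x => complex.Im (u x))).

Lemma cintegral_lin (a : C) u v : cintegrable u -> cintegrable v ->
  cintegrable (fun x => a * u x + v x) /\
  cintegral mu (fun x => a * u x + v x) = a * cintegral mu u + cintegral mu v.
Proof.
move=> [ur ui] [vr vi].
have iZ k (g : borelType G -> R) : mu.-integrable setT (EFin \o g) ->
    mu.-integrable setT (EFin \o (fun x => k * g x)).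
  by move=> ig; exact: (integrableZl measurableT k ig).
have iD (f g : borelType G -> R) : mu.-integrable setT (EFin \o f) ->
    mu.-integrable setT (EFin \o g) -> mu.-integrable setT (EFin \o (fun x => f x + g x)).
  by move=> iff ig; exact: (integrableD measurableT iff ig).
have eRe : (fun x => complex.Re (a * u x + v x)) =
    (fun x => (complex.Re a * complex.Re (u x) + - complex.Im a * complex.Im (u x)) + complex.Re (v x)).
  by apply/funext => x; rewrite !reimE mulNr.
have eIm : (fun x => complex.Im (a * u x + v x)) =
    (fun x => (complex.Re a * complex.Im (u x) + complex.Im a * complex.Re (u x)) + complex.Im (v x)).
  by apply/funext => x; rewrite !reimE.
split; first by rewrite /cintegrable eRe eIm; split;
    apply: (iD _ _ _ _) => //; apply: (iD _ _ _ _); apply: (iZ _ _ _).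
rewrite /cintegral eRe eIm; apply/eqP; rewrite eq_complex !reimE /=.
rewrite !(RintegralD measurableT, RintegralZl _ measurableT) ?mulNr ?eqxx //;
  by [exact: iZ|apply: iD; exact: iZ].
Qed.

Lemma cintegrable0 : cintegrable (fun=> 0).
Proof. by split; exact: integrable0. Qed.

Lemma cintegral0 : cintegral mu (fun=> 0) = 0.
Proof.
have [_] := cintegral_lin (-1) cintegrable0 cintegrable0.
rewrite (_ : (fun=> _) = fun=> 0); last by apply/funext => x; rewrite mulr0 addr0.
by rewrite mulN1r addNr.
Qed.

Lemma cintegral_sum (I : Type) (s : seq I) (c : I -> C) (F : I -> borelType G -> C) :
  (forall i, cintegrable (F i)) ->
  cintegrable (fun x => \sum_(i <- s) c i * F i x) /\
  cintegral mu (fun x => \sum_(i <- s) c i * F i x) =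
    \sum_(i <- s) c i * cintegral mu (F i).
Proof.
move=> iF; elim: s => [|i s [IH1 IH2]].
  rewrite big_nil (_ : (fun x => _) = fun=> 0); last first.
    by apply/funext => x; rewrite big_nil.
  by split; [exact: cintegrable0|exact: cintegral0].
rewrite big_cons -IH2 (_ : (fun x => _) =
  fun x => c i * F i x + \sum_(j <- s) c j * F j x); last first.
  by apply/funext => x; rewrite big_cons.
exact: cintegral_lin.
Qed.

Lemma cintegral_conj u : cintegrable u ->
  cintegral mu (fun x => Num.conj (u x)) = Num.conj (cintegral mu u).
Proof.
move=> [_ ui]; apply/eqP; rewrite eq_complex !reimE /=.
under eq_Rintegral do rewrite Re_conj.
under [X in _ && (X == _)]eq_Rintegral do rewrite Im_conj -mulN1r.
by rewrite RintegralZl // mulN1r !eqxx.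
Qed.

Lemma cintegral_aeq u v : cintegrable u -> cintegrable v ->
  {ae mu, forall x, u x = v x} -> cintegral mu u = cintegral mu v.
Proof.
move=> [ur ui] [vr vi] uv; apply/eqP; rewrite eq_complex /= /Rintegral.
have ae (p : C -> R) : mu.-integrable setT (EFin \o (p \o u)) ->
    mu.-integrable setT (EFin \o (p \o v)) ->
    (\int[mu]_x (p (u x))%:E = \int[mu]_x (p (v x))%:E)%E.
  move=> pu pv; apply: ae_eq_integral => //.
  - exact: measurable_int pu.
  - exact: measurable_int pv.
  - by apply: filterS uv => x uvx _; rewrite /= uvx.
by rewrite (ae (@complex.Re R)) // (ae (@complex.Im R)) // !eqxx.
Qed.

(** The condition that [inL2] puts on each entry, phrased so that [change] can pass between the
    two. *)
Definition sqint u : Prop :=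
  [/\ measurable_fun setT (fun x => complex.Re (u x)),
      measurable_fun setT (fun x => complex.Im (u x))
    & (\int[mu]_x ((complex.Re (u x)) ^+ 2 + (complex.Im (u x)) ^+ 2)%:E
        < +oo)%E].

Lemma sqint_integrable u : sqint u -> mu.-integrable setT
  (EFin \o (fun x => (complex.Re (u x)) ^+ 2 + (complex.Im (u x)) ^+ 2)).
Proof.
move=> [mr mi lt]; apply/integrableP; split.
  by apply/measurable_EFinP; apply: measurable_funD; exact: measurable_funX.
rewrite (le_lt_trans _ lt) //; apply: ge0_le_integral => //.
- by apply: measurableT_comp => //; apply/measurable_EFinP; apply: measurable_funD; exact: measurable_funX.
- by apply/measurable_EFinP; apply: measurable_funD; exact: measurable_funX.
- by move=> x _ /=; rewrite lee_fin ger0_norm // addr_ge0 ?sqr_ge0.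
Qed.

Lemma sqint_dominated u (g : borelType G -> R) :
  measurable_fun setT (fun x => complex.Re (u x)) ->
  measurable_fun setT (fun x => complex.Im (u x)) ->
  mu.-integrable setT (EFin \o g) ->
  (forall x, (complex.Re (u x)) ^+ 2 + (complex.Im (u x)) ^+ 2 <= g x) -> sqint u.
Proof.
move=> mr mi ig ug; split => //.
have mg := measurable_int _ ig.
have /integrableP[_] := ig; apply: le_lt_trans; apply: ge0_le_integral => //.
- by move=> x _; rewrite lee_fin addr_ge0 ?sqr_ge0.
- by apply/measurable_EFinP; apply: measurable_funD; exact: measurable_funX.
- exact: measurableT_comp.
- by move=> x _ /=; rewrite lee_fin (le_trans (ug x)) // ler_norm.
Qed.

Lemma sqint_lin (a : C) u v : sqint u -> sqint v -> sqint (fun x => a * u x + v x).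
Proof.
move=> su sv; have iu := sqint_integrable su; have iv := sqint_integrable sv.
case: su sv => [ur ui _] [vr vi _].
(* Parallelogram law: [2 |a u|^2 + 2 |v|^2 - |a u + v|^2] is the square [|a u - v|^2]. *)
set A := 2 * ((complex.Re a) ^+ 2 + (complex.Im a) ^+ 2).
apply: (@sqint_dominated _ (fun x =>
  A * ((complex.Re (u x)) ^+ 2 + (complex.Im (u x)) ^+ 2) +
  2 * ((complex.Re (v x)) ^+ 2 + (complex.Im (v x)) ^+ 2))).
- under [X in measurable_fun _ X]eq_fun do rewrite !reimE.
  by apply: measurable_funD => //; apply: measurable_funB; exact: measurable_funM.
- under [X in measurable_fun _ X]eq_fun do rewrite !reimE.
  by apply: measurable_funD => //; apply: measurable_funD; exact: measurable_funM.
- exact: (integrableD measurableT (integrableZl measurableT A iu)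
    (integrableZl measurableT 2 iv)).
- move=> x; rewrite !reimE /A -subr_ge0.
  move: (complex.Re a) (complex.Im a) (complex.Re (u x)) (complex.Im (u x))
    (complex.Re (v x)) (complex.Im (v x)) => p q r s t w.
  rewrite [leRHS](_ : _ = (p * r - q * s - t) ^+ 2 + (p * s + q * r - w) ^+ 2); last ring.
  by rewrite addr_ge0 ?sqr_ge0.
Qed.

Lemma sqint0 : sqint (fun=> 0).
Proof.
apply: (@sqint_dominated _ (fun=> 0)) => // [|x]; first exact: integrable0.
by rewrite /= expr0n addr0.
Qed.

Lemma sqint_sum (I : Type) (s : seq I) (c : I -> C) (F : I -> borelType G -> C) :
  (forall i, sqint (F i)) -> sqint (fun x => \sum_(i <- s) c i * F i x).
Proof.
move=> F2; elim: s => [|i s IH].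
  rewrite (_ : (fun x => _) = fun=> 0); first exact: sqint0.
  by apply/funext => x; rewrite big_nil.
rewrite (_ : (fun x => _) = fun x => c i * F i x + \sum_(j <- s) c j * F j x).
  exact: sqint_lin.
by apply/funext => x; rewrite big_cons.
Qed.

Lemma sqint_mul u v : sqint u -> sqint v -> cintegrable (fun x => u x * Num.conj (v x)).
Proof.
move=> su sv; have iu := sqint_integrable su; have iv := sqint_integrable sv.
case: su sv => [ur ui _] [vr vi _].
have iuv := integrableD measurableT iu iv.
(* With [(p, q)] the parts of [u], the real part takes [(r, s)] to be the parts of [v], and the
   imaginary part takes the rotated pair [(- Im v, Re v)]. *)
have key (p q r s : R) : `|p * r + q * s| <= (p ^+ 2 + q ^+ 2) + (r ^+ 2 + s ^+ 2).
  have := sqr_ge0 (p - r); have := sqr_ge0 (q - s).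
  have := sqr_ge0 (p + r); have := sqr_ge0 (q + s).
  have := sqr_ge0 p; have := sqr_ge0 q; have := sqr_ge0 r; have := sqr_ge0 s.
  by rewrite ler_norml !expr2 => *; apply/andP; split; lra.
split; apply: (le_integrable _ _ _ iuv) => //.
- apply/measurable_EFinP; under [X in measurable_fun _ X]eq_fun do rewrite !reimE.
  by apply: measurable_funB; apply: measurable_funM => //; exact: measurableT_comp.
- move=> x _; rewrite /= lee_fin !reimE mulrN opprK [leRHS]ger0_norm ?addr_ge0 ?sqr_ge0 //.
- apply/measurable_EFinP; under [X in measurable_fun _ X]eq_fun do rewrite !reimE.
  by apply: measurable_funD; apply: measurable_funM => //; exact: measurableT_comp.
- move=> x _; rewrite /= lee_fin !reimE [leRHS]ger0_norm ?addr_ge0 ?sqr_ge0 //.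
  set p := complex.Re (u x); set q := complex.Im (u x).
  have := key p q (- complex.Im (v x)) (complex.Re (v x)).
  by rewrite sqrrN [_ + complex.Re (v x) ^+ 2]addrC.
Qed.

End SquareIntegrable.

(** Traces against matrix units detect every entry, which later turns an identity of scalar products
    into one of matrix-valued products. *)
Lemma trace_delta_mul (K : pzSemiRingType) (n : nat) (M : 'M[K]_n) i k :
  \tr (delta_mx k i *m M) = M i k.
Proof.
rewrite /mxtrace (bigD1 k) //= [X in _ + X]big1 => [|l lk].
  rewrite addr0 mxE (bigD1 i) //= big1 => [|j ji]; first by rewrite mxE !eqxx mul1r addr0.
  by rewrite mxE (negPf ji) andbF mul0r.
by rewrite mxE big1 // => j _; rewrite mxE (negPf lk) mul0r.
Qed.


(** * The matrix-valued inner product on square-integrable matrix functions *)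

Section MatrixL2.
Variables (R : realType) (G : topologicalZmodType)
  (mu : {measure set (borelType G) -> \bar R}) (s r : nat).
Local Notation C := (Cplx R).
Local Notation Mf := (borelType G -> 'M[C]_(s, r)).
Implicit Types (f g : Mf) (A : 'M[C]_s).

Lemma inL2_lin (a : C) f g :
  inL2 mu f -> inL2 mu g -> inL2 mu (a *: f + g).
Proof.
move=> f2 g2 i j; change (sqint mu (fun x => (a *: f + g) x i j)).
rewrite (_ : (fun x => _) = fun x => a * f x i j + g x i j).
  exact: sqint_lin (f2 i j) (g2 i j).
by apply/funext => x; rewrite !mxE.
Qed.

Lemma inL2_0 : inL2 mu (0 : Mf).
Proof.
move=> i j; change (sqint mu (fun x => (0 : Mf) x i j)).
rewrite (_ : (fun x => _) = fun=> 0); first exact: sqint0.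
by apply/funext => x; rewrite mxE.
Qed.

Lemma inL2_mul A f : inL2 mu f -> inL2 mu (fun x => A *m f x).
Proof.
move=> f2 i j; change (sqint mu (fun x => (A *m f x) i j)).
rewrite (_ : (fun x => _) = fun x => \sum_l A i l * f x l j).
  by apply: sqint_sum => l; exact: f2.
by apply/funext => x; rewrite mxE.
Qed.

Lemma mip_cintegrable f g i k : inL2 mu f -> inL2 mu g ->
  cintegrable mu (fun x => (f x *m (map_mx Num.conj (g x))^T) i k).
Proof.
move=> f2 g2; rewrite (_ : (fun x => _) =
  fun x => \sum_j 1 * (f x i j * Num.conj (g x k j))); last first.
  by apply/funext => x; rewrite mxE; under eq_bigr do rewrite !mxE -[_ * _]mul1r.
have /(_ mu) := @cintegral_sum R G.
move=> /(_ _ (index_enum 'I_r) (fun=> 1) (fun j x => f x i j * Num.conj (g x k j))).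
by case=> // j; exact: sqint_mul (f2 i j) (g2 k j).
Qed.

Lemma mip_lin (a : C) f g z : inL2 mu f -> inL2 mu g -> inL2 mu z ->
  mip mu (a *: f + g) z = a *: mip mu f z + mip mu g z.
Proof.
move=> f2 g2 z2; apply/matrixP => i k; rewrite !mxE.
have [_ <-] := cintegral_lin a (mip_cintegrable i k f2 z2) (mip_cintegrable i k g2 z2).
by congr cintegral; apply/funext => x; rewrite mulmxDl -scalemxAl !mxE.
Qed.

Lemma mip_mul A f g : inL2 mu f -> inL2 mu g ->
  mip mu (fun x => A *m f x) g = A *m mip mu f g.
Proof.
move=> f2 g2; apply/matrixP => i k; rewrite !mxE.
under [RHS]eq_bigr do rewrite mxE.
have [_ <-] := @cintegral_sum R G mu _ (index_enum 'I_s) (A i)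
  (fun l x => (f x *m (map_mx Num.conj (g x))^T) l k)
  (fun l => mip_cintegrable l k f2 g2).
by congr cintegral; apply/funext => x; rewrite -mulmxA mxE.
Qed.

Lemma mip_conj f g : inL2 mu f -> inL2 mu g ->
  mip mu g f = (map_mx Num.conj (mip mu f g))^T.
Proof.
move=> f2 g2; apply/matrixP => i k; rewrite !mxE.
rewrite -cintegral_conj; last exact: mip_cintegrable.
congr cintegral; apply/funext => x; rewrite !mxE rmorph_sum.
by apply: eq_bigr => j _; rewrite !mxE rmorphM /= conjCK mulrC.
Qed.

Lemma mip_aeq f f' g : inL2 mu f -> inL2 mu f' -> inL2 mu g ->
  aeq mu f f' -> mip mu f g = mip mu f' g.
Proof.
move=> f2 f'2 g2 ff'; apply/matrixP => i k; rewrite !mxE.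
apply: cintegral_aeq; [exact: mip_cintegrable..|].
by apply: filterS ff' => x ->.
Qed.

Lemma hip_fnorm f : inL2 mu f -> hip mu f f = real_complex R ((fnorm mu f) ^+ 2).
Proof.
move=> f2; rewrite /fnorm sqr_sqrtr; last first.
  apply: sumr_ge0 => i _; apply: sumr_ge0 => j _; apply: Rintegral_ge0 => x _.
  by rewrite addr_ge0 ?sqr_ge0.
rewrite rmorph_sum; apply: eq_bigr => i _; rewrite mxE rmorph_sum.
rewrite (_ : (fun x => _) =
  fun x => \sum_j 1 * (f x i j * Num.conj (f x i j))); last first.
  by apply/funext => x; rewrite mxE; under eq_bigr do rewrite !mxE -[_ * _]mul1r.
have [|_ ->] := @cintegral_sum R G mu _ (index_enum 'I_r) (fun=> 1)
  (fun j x => f x i j * Num.conj (f x i j)).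
  by move=> j; exact: sqint_mul (f2 i j) (f2 i j).
apply: eq_bigr => j _; rewrite mul1r /cintegral /=.
apply/eqP; rewrite eq_complex /=; apply/andP; split; apply/eqP.
  by apply: eq_Rintegral => x _; rewrite !reimE mulrN opprK !expr2.
rewrite (_ : (fun x => _) = fun=> 0); first by rewrite /Rintegral integral0.
by apply/funext => x; rewrite !reimE mulrN mulrC addNr.
Qed.

Lemma hip_lin (a : C) f g z : inL2 mu f -> inL2 mu g -> inL2 mu z ->
  hip mu (a *: f + g) z = a * hip mu f z + hip mu g z.
Proof. by move=> f2 g2 z2; rewrite /hip mip_lin // linearD linearZ. Qed.

Lemma hip_conj f g : inL2 mu f -> inL2 mu g -> hip mu g f = Num.conj (hip mu f g).
Proof.
by move=> f2 g2; rewrite /hip mip_conj // mxtrace_tr trace_map_mx.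
Qed.

(** Makes the square-integrable functions a module to which the abstract results apply. Functions
    equal almost everywhere are not identified, so [hip] is only a semi-inner product on it. *)
Definition L2pred : {pred Mf} := fun f => `[< inL2 mu f >].

Lemma L2pred_submod : submod_closed L2pred.
Proof.
split; first by apply/asboolP; exact: inL2_0.
by move=> a f g /asboolP f2 /asboolP g2; apply/asboolP; exact: inL2_lin.
Qed.

HB.instance Definition _ := GRing.isSubmodClosed.Build C Mf L2pred L2pred_submod.

Record L2space := L2Space { L2val :> Mf; _ : L2val \in L2pred }.
HB.instance Definition _ := [isSub for L2val].
HB.instance Definition _ := [Choice of L2space by <:].
HB.instance Definition _ := [SubChoice_isSubLmodule of L2space by <:].

Definition L2lift (U : Mf -> Mf) (U2 : forall f, inL2 mu f -> inL2 mu (U f))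
    (x : L2space) : L2space :=
  L2Space (introT (asboolP _) (U2 _ (elimT (asboolP _) (valP x)))).

Lemma L2valP (x : L2space) : inL2 mu x.
Proof. exact: (elimT (asboolP _) (valP x)). Qed.

Lemma mip_mulr A f g : inL2 mu f -> inL2 mu g ->
  mip mu f (fun x => A *m g x) = mip mu f g *m (map_mx Num.conj A)^T.
Proof.
move=> f2 g2; rewrite mip_conj //; last exact: inL2_mul.
by rewrite mip_mul // map_mxM trmx_mul -mip_conj.
Qed.

Lemma conj_trmxK A : (map_mx Num.conj (map_mx Num.conj A)^T)^T = A.
Proof. by apply/matrixP => i j; rewrite !mxE conjCK. Qed.

(** A constant factor leaves the first argument of [mip] on the left and, conjugate-transposed, the
    second on the right; the trace is cyclic. *)
Lemma hip_mul A f g : inL2 mu f -> inL2 mu g ->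
  hip mu (fun x => A *m f x) g = hip mu f (fun x => (map_mx Num.conj A)^T *m g x).
Proof.
by move=> f2 g2; rewrite /hip mip_mul // mip_mulr // conj_trmxK mxtrace_mulC.
Qed.

(** * The square root is adjointable and bijective *)

Lemma sqrt_op_mul (T W : Mf -> Mf) A f g :
  op_wd mu T -> op_adjointable mu T -> is_sqrt_op mu T W ->
  inL2 mu f -> inL2 mu g ->
  hip mu (fun x => A *m W f x) g = hip mu (W (fun x => A *m f x)) g.
Proof.
move=> [T2 _] [V [V2 _] TV] [[W2 _] _ [c Wc] [W_sym W_ge0] WW] f2 g2.
pose h (x y : L2space) := hip mu x y.
have hP a x y z : h (a *: x + y) z = a * h x z + h y z.
  by apply: hip_lin; exact: L2valP.
have hC x y : h y x = Num.conj (h x y) by apply: hip_conj; exact: L2valP.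
have h_ge0 x : 0 <= h x x.
  by rewrite /h hip_fnorm ?ler0c ?sqr_ge0 //; exact: L2valP.
pose WL := L2lift W2.
pose AL B := L2lift (@inL2_mul B).
(* The constant in [op_bounded] has no prescribed sign, whereas the scaling needs a positive one. *)
pose c1 := `|c| + 1.
have c1_gt0 : 0 < c1 by rewrite ltr_wpDl.
have WL_le x : h (WL x) (WL x) <= real_complex R c1 ^+ 2 * h x x.
  have x2 := L2valP x.
  rewrite /h !hip_fnorm //; last exact: (W2 _).
  have Wc1 : fnorm mu (W x) <= c1 * fnorm mu x.
    rewrite (le_trans (Wc _ x2)) // ler_wpM2r ?sqrtr_ge0 //.
    by rewrite (le_trans (ler_norm c)) // lerDl.
  rewrite -rmorphXn -rmorphM lecR -exprMn.
  by apply: lerXn2r Wc1; rewrite nnegrE ?mulr_ge0 ?sqrtr_ge0 // ltW.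
have AA x y : h (AL A x) y = h x (AL (map_mx Num.conj A)^T y).
  by apply: hip_mul; exact: L2valP.
(* After replacing [W W] by [T], both sides become the trace of [A <x, V y>], where [V] is the
   matrix-valued adjoint of [T]. *)
have AW x : h (AL A (WL (WL x))) = h (WL (WL (AL A x))).
  apply/funext => y; have x2 := L2valP x; have y2 := L2valP y.
  have Ax2 := inL2_mul A x2.
  rewrite /h /hip /= mip_mul //; try by do 2?apply: (W2 _).
  rewrite (mip_aeq _ _ _ (WW _ x2)) ?(mip_aeq _ _ _ (WW _ Ax2)) //;
    try by [do 2?apply: (W2 _)|apply: (T2 _)].
  by rewrite !TV // mip_mul //; apply: (V2 _).
have c1C : 0 < real_complex R c1 by rewrite ltcR.
have key := @bounded_sqrt_commute _ _ h WL (AL A) (AL (map_mx Num.conj A)^T)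
  (real_complex R c1) hP hC h_ge0 (@complex_archimedean R)
  (fun x y => W_sym _ _ (L2valP x) (L2valP y)) (fun x => W_ge0 _ (L2valP x))
  c1C WL_le AA AW.
pose fL := L2Space (introT (asboolP _) f2); pose gL := L2Space (introT (asboolP _) g2).
exact: (congr1 (@^~ gL) (key fL)).
Qed.

Lemma sqrt_op_mip (T W : Mf -> Mf) f g :
  op_wd mu T -> op_adjointable mu T -> is_sqrt_op mu T W ->
  inL2 mu f -> inL2 mu g -> mip mu (W f) g = mip mu f (W g).
Proof.
move=> T2 Tadj TW f2 g2; apply/matrixP => i k.
have [[W2 _] _ _ [W_sym _] _] := TW.
have := etrans (sqrt_op_mul (delta_mx k i) T2 Tadj TW f2 g2)
  (W_sym _ _ (inL2_mul _ f2) g2).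
rewrite /hip (mip_mul _ (W2 _ f2) g2) (mip_mul _ f2 (W2 _ g2)).
move=> E; apply: etrans (esym (trace_delta_mul (mip mu (W f) g) i k)) _.
exact: (etrans E (trace_delta_mul (mip mu f (W g)) i k)).
Qed.

Lemma aeq_sym f g : aeq mu f g -> aeq mu g f.
Proof. by move=> fg; apply: filterS fg => x ->. Qed.

Lemma aeq_trans f g k : aeq mu f g -> aeq mu g k -> aeq mu f k.
Proof. by move=> fg gk; apply: filterS2 fg gk => x -> ->. Qed.

Lemma sqrt_op_good (T W : Mf -> Mf) :
  good_op mu T -> is_sqrt_op mu T W -> good_op mu W.
Proof.
move=> [T2 _ _ [Tinj Tsurj] Tadj] TW.
have [[W2 Wae] Wlin Wbd _ WW] := TW.
split; [exact: (conj W2 Wae)|exact: Wlin|exact: Wbd| |]; last first.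
  by exists W; [exact: (conj W2 Wae)|move=> f g; exact: sqrt_op_mip TW].
(* Applying [W] to [W f = W g] gives [T f = T g], hence injectivity; if [T f = g], then [W f] is a
   preimage of [g] under [W]. *)
split=> [f g f2 g2 Wfg|g g2].
  apply: Tinj => //; apply: aeq_trans (WW _ g2).
  by apply: aeq_trans (aeq_sym (WW _ f2)) _; apply: Wae => //; exact: (W2 _).
have [f f2 Tfg] := Tsurj _ g2.
by exists (W f); [exact: (W2 _)|apply: aeq_trans (WW _ f2) Tfg].
Qed.

End MatrixL2.

Theorem theorem3p6 (R : realType) (G : topologicalZmodType)
  (mu : {measure set (borelType G) -> \bar R}) (s r : nat) :
  (0 < s)%N -> (0 < r)%N ->
  LCA_metrizable_sigma_compact R G -> Haar_measure mu ->
  forall (T : (borelType G -> 'M[Cplx R]_(s, r)) -> (borelType G -> 'M[Cplx R]_(s, r)))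
         (E : nat -> borelType G -> 'M[Cplx R]_(s, r)),
  good_op mu T -> mx_ONB mu E -> op_positive mu T ->
  forall W : (borelType G -> 'M[Cplx R]_(s, r)) -> (borelType G -> 'M[Cplx R]_(s, r)),
  is_sqrt_op mu T W ->
  (mx_Riesz_basis mu (fun k => T (E k)) <-> mx_Riesz_basis mu (fun k => W (E k))).
Proof.
move=> _ _ _ _ T E Tgood Eonb _ W TW.
have riesz U : good_op mu U -> mx_Riesz_basis mu (fun k => U (E k)).
  by move=> Ugood; exists E, U; split=> // k; apply: aeW.
split=> _; first exact: riesz (sqrt_op_good Tgood TW).
exact: riesz Tgood.
Qed.
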